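(* Let $q$ be an odd prime power, $d$ and $k$ positive integers, and $0<\varepsilon<q-1$. Let $\mathcal{P}\subseteq\mathbb{F}_q^d$ with $|\mathcal{P}|\ge(1+\varepsilon)q^{k-1}$. Then the number of lines spanned by $\mathcal{P}$ is at least $(1-o(1))\alpha_\varepsilon q^{2k-2}$, where $\alpha_\varepsilon=\varepsilon^2(1+\varepsilon+\varepsilon^2)^{-1}$.
   Context: A line in $\mathbb{F}_q^d$ is an affine line $\{\mathbf{a}+t\mathbf{v}: t\in\mathbb{F}_q\}$ with $\mathbf{v}\neq\mathbf{0}$. A line is spanned by $\mathcal{P}$ if it contains at least two points of $\mathcal{P}$. Here $o(1)$ denotes a quantity tending to $0$ as $q\to\infty$. *)

(* Defs.v *)
From mathcomp Require Import all_boot all_order all_algebra.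

Set Implicit Arguments.
Unset Strict Implicit.
Unset Printing Implicit Defensive.

Import GRing.Theory.
Local Open Scope ring_scope.

Section Lines.
Variables (F : finFieldType) (d : nat).
Implicit Types (a v : 'rV[F]_d) (l P : {set 'rV[F]_d}).

Definition line a v : {set 'rV[F]_d} := [set a + t *: v | t : F].

Definition is_line l : bool :=
  [exists a, exists v, (v != 0) && (l == line a v)].

Definition spanned_lines P : {set {set 'rV[F]_d}} :=
  [set l | is_line l && (2 <= #|l :&: P|)%N].

End Lines.

Definition alpha (R : fieldType) (eps : R) : R :=
  eps ^+ 2 * (1 + eps + eps ^+ 2)^-1.

(* Main.v *)
Require Import Defs.
From mathcomp Require Import all_boot all_order all_algebra.
From mathcomp Require Import ring lra.

(** Let [m = k - 1] and choose an affine map [f x = x A + b] from [F^d] to [F^m]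
    uniformly at random.  The values of [f] at two distinct points are
    independent and uniform, so the number [X] of zeros of [f] in [P] has mean
    [mu = #|P| / q^m >= 1 + eps] and variance at most [mu].  Cantelli's inequality
    gives [Pr (X >= 2) >= (mu - 1)^2 / ((mu - 1)^2 + mu) >= alpha eps].  If
    [X >= 2] then [f] vanishes on a line spanned by [P], and it vanishes on a
    given line with probability [q^(- 2m)].  By the union bound the number of
    spanned lines is at least [alpha eps * q^(2m)]: the error term is zero. *)

Import Order.TTheory GRing.Theory Num.Theory.
Local Open Scope ring_scope.

Lemma sum_nat_of_bool (T : finType) (p : pred T) :
  (\sum_x (p x : nat) = #|[set x | p x]|)%N.
Proof. by rewrite -big_mkcond sum1_card cardsE. Qed.

Section AffineMaps.
Context {F : finFieldType} {d m : nat}.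
Implicit Types (x y v : 'rV[F]_d) (w : 'rV[F]_m) (P : {set 'rV[F]_d}).
Implicit Types (f : 'M[F]_(d, m) * 'rV[F]_m).

Definition affine_eval f x : 'rV[F]_m := x *m f.1 + f.2.

Definition zeros f P : {set 'rV[F]_d} := [set x in P | affine_eval f x == 0].

Definition annihilators v : {set 'M[F]_(d, m)} := [set A | v *m A == 0].

Lemma mulmx_right_inverse v : v != 0 -> exists u : 'cV[F]_d, v *m u = 1%:M.
Proof.
move=> v0.
have /row_freeP[u vu] : row_free v by rewrite /row_free rank_rV v0.
by exists u.
Qed.

(** Fix [u] with [v *m u = 1]. Every matrix is uniquely [u *m w + A] with [A] annihilated by [v], so
    the count times [q^m] is [q^(d * m)]. *)
Lemma card_annihilators v : v != 0 ->
  #|annihilators v| = (#|F| ^ (d.-1 * m))%N.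
Proof.
move=> v0; have [u vu] := mulmx_right_inverse v v0.
have d_gt0 : (0 < d)%N by rewrite (leq_trans _ (rank_leq_col v)) // rank_rV v0.
have q_gt0 : (0 < #|F| ^ m)%N by rewrite expn_gt0 (ltnW (card_finNzRing_gt1 F)).
apply/eqP; rewrite -(eqn_pmul2l q_gt0) -expnD -mulSn prednK // -card_mx.
apply/eqP; rewrite -[RHS]cardsT.
have <- : [set (u *m p.1 + p.2 : 'M[F]_(d, m)) |
             p in setX [set: 'rV[F]_m] (annihilators v)] = [set: _].
  apply/setP=> A; rewrite in_setT; apply/imsetP.
  exists (v *m A, A - u *m (v *m A)); last by rewrite /= addrC subrK.
  by rewrite !inE /= mulmxBr (mulmxA v) vu mul1mx subrr.
rewrite card_in_imset ?cardsX ?cardsT ?card_mx ?mul1n // => -[w A] [w' A'].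
rewrite !inE /= => /eqP vA /eqP vA' eqA.
have eq_w : w = w'.
  have := congr1 (mulmx v) eqA.
  by rewrite !mulmxDr vA vA' !addr0 !mulmxA vu !mul1mx.
by move: eqA; rewrite eq_w => /addrI ->.
Qed.

(** Each linear part [A] admits exactly one translation part, [- (x *m A)]. *)
Lemma card_affine_zero x :
  #|[set f | affine_eval f x == 0]| = (#|F| ^ (d * m))%N.
Proof.
rewrite -card_mx -(card_imset _ (_ : injective (fun A : 'M[F]_(d, m) => (A, - (x *m A))))).
  apply: eq_card => -[A b]; rewrite !inE /affine_eval /= addrC addr_eq0.
  apply/eqP/imsetP => [->|[A' _ [-> ->]] //]; by exists A.
by move=> A A' [].
Qed.

(** The translation part is forced by the zero at [x]; the zero at [y] then says that [A] kills
    [x - y]. *)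
Lemma card_affine_zero2 x y :
  #|[set f | (affine_eval f x == 0) && (affine_eval f y == 0)]| =
  #|annihilators (x - y)|.
Proof.
rewrite -(card_imset _ (_ : injective (fun A : 'M[F]_(d, m) => (A, - (x *m A))))).
  apply: eq_card => -[A b]; rewrite !inE /affine_eval /= !addr_eq0.
  apply/andP/imsetP => [[/eqP xA /eqP yA]|[A' + [-> ->]]].
    by exists A; rewrite ?inE ?mulmxBl xA ?yA ?subrr ?opprK.
  by rewrite inE mulmxBl subr_eq0 => /eqP <-; rewrite opprK.
by move=> A A' [].
Qed.

Lemma card_zerosE f P : #|zeros f P| = (\sum_(x in P) (affine_eval f x == 0%R))%N.
Proof.
rewrite -sum1_card big_mkcond [RHS]big_mkcond /=.
by apply: eq_bigr => x _; rewrite inE; case: (x \in P); case: (_ == 0).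
Qed.

Lemma sum_card_zeros P :
  (\sum_f #|zeros f P| = #|P| * #|F| ^ (d * m))%N.
Proof.
under eq_bigr => f _ do rewrite card_zerosE.
rewrite exchange_big /= -sum_nat_const; apply: eq_bigr => x _.
by rewrite sum_nat_of_bool card_affine_zero.
Qed.

(** The square counts ordered pairs of zeros: the diagonal gives the first summand, pairs of
    distinct points the second. *)
Lemma sum_card_zeros_sqr P :
  (\sum_f #|zeros f P| ^ 2 =
   #|P| * (#|F| ^ (d * m) + #|P|.-1 * #|F| ^ (d.-1 * m)))%N.
Proof.
under eq_bigr => f _.
  rewrite card_zerosE expnS expn1 big_distrl /=.
  under eq_bigr => x _ do rewrite big_distrr /=.
  over.
rewrite exchange_big /= -sum_nat_const; apply: eq_bigr => x Px.
rewrite exchange_big /= (bigD1 x) //=; congr addn.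
  under eq_bigr => f _ do rewrite mulnb andbb.
  by rewrite sum_nat_of_bool card_affine_zero.
have -> : #|P|.-1 = #|P :\ x| by rewrite (cardsD1 x P) Px.
rewrite -sum_nat_const; apply: eq_big => [y|y /andP[_ yx]].
  by rewrite in_setD1 andbC.
under eq_bigr => f _ do rewrite mulnb.
by rewrite sum_nat_of_bool card_affine_zero2 card_annihilators // subr_eq0 eq_sym.
Qed.

Lemma affine_zero_line f x y z : affine_eval f x = 0 -> affine_eval f y = 0 ->
  z \in line x (y - x) -> affine_eval f z = 0.
Proof.
rewrite /affine_eval => fx fy /imsetP[t _ ->].
rewrite mulmxDl -scalemxAl mulmxBl addrAC fx add0r.
by rewrite (addIr f.2 (etrans fx (esym fy))) subrr scaler0.
Qed.

Lemma mem_spanned_lines P x y : x \in P -> y \in P -> x != y ->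
  line x (y - x) \in spanned_lines P.
Proof.
move=> Px Py xy; rewrite inE; apply/andP; split.
  apply/existsP; exists x; apply/existsP; exists (y - x).
  by rewrite subr_eq0 eq_sym xy eqxx.
apply/card_gt1P; exists x, y; split => //; rewrite inE ?Px ?Py andbT.
  by apply/imsetP; exists 0; rewrite // scale0r addr0.
by apply/imsetP; exists 1; rewrite // scale1r addrC subrK.
Qed.

(** Double counting of pairs of a map and a spanned line on which it vanishes. *)
Lemma card_two_zeros_le P :
  (#|[set f | 2 <= #|zeros f P|]| <=
   #|spanned_lines P| * #|F| ^ (d.-1 * m))%N.
Proof.
(* Zeros are taken in the whole space, as a spanned line may leave [P]. *)
pose vanish (l : {set _}) f := l \subset zeros f setT.
have -> : #|[set f | 2 <= #|zeros f P|]|%N = (\sum_f (2 <= #|zeros f P| : nat))%N.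
  by rewrite sum_nat_of_bool.
apply: (@leq_trans (\sum_f \sum_(l in spanned_lines P) (vanish l f : nat))%N).
  apply: leq_sum => f _; case: ltnP => // /card_gt1P[x [y []]].
  rewrite !inE => /andP[Px /eqP fx] /andP[Py /eqP fy] xy.
  rewrite (bigD1 (line x (y - x))) ?mem_spanned_lines //=.
  have -> // : vanish (line x (y - x)) f.
  apply/subsetP => z zl; rewrite !inE /=.
  by apply/eqP; apply: affine_zero_line zl.
rewrite exchange_big /= -sum_nat_const; apply: leq_sum => l.
rewrite inE => /andP[_ /card_gt1P[x [y []]]].
rewrite !inE => /andP[xl _] /andP[yl _] xy.
have xy0 : x - y != 0 by rewrite subr_eq0.
(* Vanishing at two distinct points of [l] is already rare enough. *)
rewrite sum_nat_of_bool -(card_annihilators _ xy0) -card_affine_zero2.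
apply/subset_leq_card/subsetP => f; rewrite !inE => /subsetP fl.
by have := fl x xl; have := fl y yl; rewrite !inE /= => -> ->.
Qed.

End AffineMaps.

(* Pointwise, [1 - (1 - lam * (X - 1)) ^+ 2] is at most [1], and it is at most
   [0] when [X <= 1]. *)
Lemma card_ge2_moments (R : realFieldType) (T : finType) (X : T -> nat) (lam : R) :
  0 <= lam ->
  2 * lam * (\sum_t ((X t)%:R - 1)) - lam ^+ 2 * (\sum_t ((X t)%:R - 1) ^+ 2)
    <= #|[set t | 2 <= X t]%N|%:R.
Proof.
move=> lam0; rewrite -sum_nat_of_bool natr_sum !mulr_sumr -sumrB.
apply: ler_sum => t _; case: ltnP => /= Xt.
  have := sqr_ge0 (1 - lam * ((X t)%:R - 1)); lra.
have : (X t)%:R <= 1 :> R by rewrite -[1]/(1%:R) ler_nat.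
move: (X t)%:R => x x1.
have : 0 <= lam * (1 - x) by rewrite mulr_ge0 // subr_ge0.
have := sqr_ge0 (lam * (x - 1)); lra.
Qed.

Lemma alpha_le (R : realFieldType) (s t : R) : 0 < s -> s <= t ->
  alpha s <= alpha t.
Proof.
move=> s0 st; have t0 : 0 < t by lra.
rewrite /alpha ler_pdivrMr; last by nra.
rewrite mulrAC ler_pdivlMr; last by nra.
(* This product is the difference of the two sides after cross-multiplication. *)
have : 0 <= (t - s) * (t + s + t * s) by apply: mulr_ge0; nra.
lra.
Qed.

Lemma spanned_lines_ge (R : realFieldType) (F : finFieldType) (d m : nat)
    (P : {set 'rV[F]_d}) (eps : R) : (0 < d)%N -> 0 < eps ->
  (1 + eps) * #|F|%:R ^+ m <= #|P|%:R ->
  alpha eps * #|F|%:R ^+ (2 * m) <= #|spanned_lines P|%:R.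
Proof.
move=> d0 eps0 leP.
set Q : R := #|F|%:R ^+ m in leP *; set n : R := #|P|%:R in leP *.
(* [c] counts the maps vanishing at two given distinct points; there are [c * Q ^+ 2] maps in
   all. *)
pose c : R := #|F|%:R ^+ (d.-1 * m).
have q0 : 0 < #|F|%:R :> R by rewrite ltr0n (ltnW (card_finNzRing_gt1 F)).
have Q0 : 0 < Q by rewrite exprn_gt0.
have c0 : 0 < c by rewrite exprn_gt0.
have cQ : #|F|%:R ^+ (d * m) = c * Q by rewrite -exprD addnC -mulSn prednK.
have n0 : 0 < n by apply: lt_le_trans leP; rewrite mulr_gt0 //; lra.
pose X (f : 'M[F]_(d, m) * 'rV[F]_m) := #|zeros f P|.
have sum1 : \sum_f ((X f)%:R - 1) = c * Q * (n - Q).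
  rewrite sumrB -natr_sum sum_card_zeros natrM natrX cQ sumr_const.
  by rewrite card_prod !card_mx mul1n natrM !natrX cQ -/n -/Q; ring.
have sum2 : \sum_f ((X f)%:R - 1) ^+ 2 = c * (n ^+ 2 - n - n * Q + Q ^+ 2).
  (* Uses [(X - 1)^2 = X^2 - 2 (X - 1) - 1], so that [sum1] applies. *)
  have -> : \sum_f ((X f)%:R - 1) ^+ 2 =
      \sum_f (X f ^ 2)%:R - \sum_f ((X f)%:R - 1) *+ 2
        - \sum_(f in {: 'M[F]_(d, m) * 'rV[F]_m}) 1 :> R.
    by rewrite -!sumrB; apply: eq_bigr => f _; rewrite natrX; ring.
  rewrite sumrMnl sum1 sumr_const card_prod !card_mx mul1n natrM !natrX cQ.
  rewrite -natr_sum sum_card_zeros_sqr natrM natrD natrM !natrX cQ -/c -/Q -/n.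
  have -> : #|P|.-1%:R = n - 1 :> R.
    by rewrite -subn1 natrB // -(ltr0n R).
  by ring.
(* [t] is the mean of [X - 1]. *)
pose t := n / Q - 1.
have nE : n = (1 + t) * Q by rewrite /t addrC subrK divfK // gt_eqF.
have t_eps : eps <= t by rewrite lerBrDl ler_pdivlMr.
have t0 : 0 < t := lt_le_trans eps0 t_eps.
have D0 : 0 < 1 + t + t ^+ 2 by nra.
apply: (@le_trans _ _ (alpha t * Q ^+ 2)).
  by rewrite mulnC exprM ler_wpM2r ?sqr_ge0 // alpha_le.
rewrite -(ler_pM2r c0).
have le_lines : #|[set f | 2 <= X f]%N|%:R <= #|spanned_lines P|%:R * c.
  by rewrite /c -natrX -natrM ler_nat card_two_zeros_le.
apply: le_trans le_lines.
(* The maximizer of [2 * lam * t - lam ^+ 2 * (1 + t + t ^+ 2)], with maximum [alpha t]; here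
   [1 + t + t ^+ 2] bounds the mean of [(X - 1)^2]. *)
pose lam := t / (1 + t + t ^+ 2).
have lam0 : 0 <= lam by rewrite divr_ge0 // ltW.
apply: le_trans (card_ge2_moments _ _ X _ lam0).
rewrite sum1 sum2.
(* The right side is the moment bound with the term [- n] of [sum2] dropped, which only lowers
   it. *)
have -> : alpha t * Q ^+ 2 * c =
    2 * lam * (c * Q * (n - Q)) - lam ^+ 2 * (c * (n ^+ 2 - n * Q + Q ^+ 2)).
  by rewrite nE /alpha /lam; field; rewrite gt_eqF.
rewrite lerD2l lerN2 ler_wpM2l ?sqr_ge0 // ler_wpM2l ?(ltW c0) //.
by rewrite lerD2r lerD2r lerBlDr lerDl ltW.
Qed.

From mathcomp Require Import all_classical all_reals all_analysis.

Import numFieldNormedType.Exports.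
Local Open Scope classical_set_scope.

Theorem theorem2p2 (R : realType) :
  exists delta : nat -> R,
    (delta q @[q --> \oo] --> (0 : R)) /\
    forall (q : nat) (F : finFieldType) (d k : nat) (eps : R)
           (P : {set 'rV[F]_d}),
      odd q -> #|F| = q ->
      (0 < d)%N -> (0 < k)%N ->
      0 < eps -> eps < q%:R - 1 ->
      (1 + eps) * q%:R ^+ (k - 1) <= #|P|%:R ->
      (1 - delta q) * alpha eps * q%:R ^+ (2 * k - 2)
        <= #|spanned_lines P|%:R.
Proof.
exists (fun=> 0); split; first exact: cvg_cst.
move=> q F d k eps P _ <- d0 _ eps0 _ leP.
(* Truncated subtraction still distributes, so the exponent is [2 * m] with [m = k - 1]. *)
rewrite subr0 mul1r -[(2 * k - 2)%N]/(2 * k - 2 * 1)%N -mulnBr.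
exact: spanned_lines_ge.
Qed.
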